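(* Let $n\ge 2$ and $k\ge 2$ be integers. If $2\lceil n/k\rceil-3\le p(n)$, then $$\widehat{\Phi}_k(n)=\max\big\{0,\ 2\lceil n/k\rceil-3\big\}.$$
   Context: For an integer $n\ge 2$, $\mathbb{Z}_n$ denotes the additive cyclic group of integers modulo $n$. For $A\subseteq\mathbb{Z}_n$ the restricted self-sumset is $A\widehat{+}A=\{a+a' : a,a'\in A,\ a\ne a'\}\subseteq\mathbb{Z}_n$ (so it is empty, of size $0$, when $|A|\le 1$). A $k$-coloring of $\mathbb{Z}_n$ is a disjoint union $\mathbb{Z}_n=A_1\sqcup\cdots\sqcup A_k$, with color classes $A_i$ (which may be empty). Define $$\widehat{\Phi}_k(n)=\min_{\mathbb{Z}_n=A_1\sqcup\cdots\sqcup A_k}\ \max_{1\le i\le k}|A_i\widehat{+}A_i|,$$ the minimum being over all $k$-colorings of $\mathbb{Z}_n$. For an integer $r\ge 2$, $p(r)$ is the least prime divisor of $r$. *)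

(* Defs.v *)
From mathcomp Require Import all_boot all_order all_algebra.
Set Implicit Arguments.
Unset Strict Implicit.
Unset Printing Implicit Defensive.
Import GRing.Theory.
Local Open Scope ring_scope.

Definition restricted_sumset (n : nat) (A : {set 'Z_n}) : {set 'Z_n} :=
  [set a + b | a in A, b in A & a != b].

(* Color classes may be empty, so this is weaker than finset's [partition]. *)
Definition is_coloring (n k : nat) (A : {ffun 'I_k -> {set 'Z_n}}) : bool :=
  [forall i, forall j, (i != j) ==> [disjoint A i & A j]]
  && (\bigcup_i A i == [set: 'Z_n]).

Definition max_restricted_sumset (n k : nat) (A : {ffun 'I_k -> {set 'Z_n}})
    : nat :=
  \max_(i < k) #|restricted_sumset (A i)|.

(* The default value #|'Z_n| of the iterated minimum bounds every term from
   above, so it does not affect the minimum when a coloring exists, i.e. when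
   0 < k; see [PhiP]. Since 'Z_n has max(n, 2) elements, only 2 <= n is
   meaningful. *)
Definition Phi (k n : nat) : nat :=
  \big[minn/#|'Z_n|]_(A : {ffun 'I_k -> {set 'Z_n}} | is_coloring A)
    max_restricted_sumset A.

Lemma PhiP (k n : nat) : (0 < k)%N ->
  (exists2 A : {ffun 'I_k -> {set 'Z_n}},
     is_coloring A & max_restricted_sumset A = Phi k n)
  /\ (forall A : {ffun 'I_k -> {set 'Z_n}},
        is_coloring A -> (Phi k n <= max_restricted_sumset A)%N).
Proof.
move=> k_gt0.
have le_card A : (@max_restricted_sumset n k A <= #|'Z_n|)%N.
  by apply/bigmax_leqP => i _; apply: max_card.
have lb (A : {ffun 'I_k -> {set 'Z_n}}) :
    is_coloring A -> (Phi k n <= max_restricted_sumset A)%N.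
  rewrite /Phi -big_filter => colA.
  have: A \in [seq B <- index_enum {ffun 'I_k -> {set 'Z_n}} | is_coloring B].
    by rewrite mem_filter colA mem_index_enum.
  elim: [seq _ <- _ | _] => // B s IHs; rewrite in_cons big_cons geq_min.
  by case/predU1P => [->|/IHs->]; rewrite ?leqnn ?orbT.
split=> //.
pose A0 : {ffun 'I_k -> {set 'Z_n}} :=
  [ffun i => if i == Ordinal k_gt0 then [set: 'Z_n] else set0].
have colA0 : is_coloring A0.
  apply/andP; split.
    apply/forallP => i; apply/forallP => j; apply/implyP => neq_ij.
    rewrite !ffunE -setI_eq0.
    have [eqi|_] := eqVneq i (Ordinal k_gt0); last by rewrite set0I.
    by rewrite -eqi (eq_sym j) (negPf neq_ij) setI0.
  apply/eqP/setP => x; rewrite inE; apply/bigcupP.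
  by exists (Ordinal k_gt0); rewrite // ffunE eqxx inE.
have [eqPhi|//] : Phi k n = #|'Z_n| \/ exists2 A : {ffun 'I_k -> {set 'Z_n}},
    is_coloring A & max_restricted_sumset A = Phi k n.
  rewrite /Phi; elim/big_ind: _ => [|x y Hx Hy|A colA]; first by left.
    by rewrite /minn; case: ifP.
  by right; exists A.
exists A0 => //; apply/eqP.
by rewrite eqn_leq (lb _ colA0) eqPhi le_card.
Qed.

(* Main.v *)
Require Import Defs.
From mathcomp Require Import all_boot all_order all_algebra.
From mathcomp Require Import all_fingroup all_solvable zify ring.
Set Implicit Arguments.
Unset Strict Implicit.
Unset Printing Implicit Defensive.
Import Order.TTheory GRing.Theory Num.Theory.
Local Open Scope ring_scope.

(** Put [m = ceil (n / k)]. Cutting [Z_n] into intervals of length [m] gives the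
    upper bound. Conversely every coloring has a class with at least [m]
    elements, so it suffices to show Karolyi's theorem that a set [A] in a finite
    abelian group whose order has least prime divisor at least [p] satisfies
    [#|A ^+ A| >= 2 #|A| - 3] as soon as [2 #|A| - 3 <= p].

    In a field of prime order this is the polynomial method of Alon, Nathanson
    and Ruzsa. In general, choose a subgroup [H] of prime order and let
    [a_1 >= a_i] be the sizes of the fibres of [A] over its image [K] in [G / H],
    [s = #|K|]. If all [a_i = 1], induct on [G / H]. Otherwise the sums [u_1 + u_i]
    carry at least [a_1 + a_i - 1] elements each by Cauchy-Davenport ([2 a_1 - 3]
    for [i = 1], by the prime case). By Cauchy-Davenport in [G / H], at least
    [s - 1] further sums in [K + K] remain; each carries an element unless it is
    the double of a point with a fibre of size [1], and every such point is
    compensated by the defect [s a_1 - #|A|]. *)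

(** * The polynomial method in a field *)

(** The weights solve a Vandermonde system, invertible because the nodes in [s] are distinct.
    Summing against [w] reads off the coefficient of [x ^ (size s - 1)] in any polynomial of degree
    less than [size s]. *)
Lemma top_coef_functional (F : fieldType) (s : seq F) : uniq s ->
  exists w : F -> F, forall i, (i < size s)%N ->
    \sum_(x <- s) w x * x ^+ i = (i.+1 == size s)%:R.
Proof.
set m := size s => s_uniq.
pose V : 'M[F]_m := Vandermonde m (\row_j s`_j).
have unitV : V \in unitmx.
  rewrite unitmxE det_Vandermonde unitfE; apply/prodf_neq0 => i _.
  apply/prodf_neq0 => j ltij; rewrite !mxE subr_eq0 nth_uniq //.
  by rewrite neq_ltn ltij orbT.
pose u : 'cV[F]_m := invmx V *m \col_i (i.+1 == m)%:R.
exists (fun x => if insub (index x s) is Some j then u j 0 else 0) => i ltim.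
transitivity ((V *m u) (Ordinal ltim) 0); last first.
  by rewrite mulKVmx // mxE.
rewrite mxE (big_nth 0) big_mkord; apply: eq_bigr => j _.
by rewrite index_uniq // valK !mxE mulrC.
Qed.

(* Integrate [(x - y) * g (x + y)], where the monic polynomial [g] of degree [2t]
   vanishes on [c], against functionals extracting the coefficient of
   [x ^ (t + 1) * y ^ t]: the result is [0], yet it is also
   ['C(2t, t) - 'C(2t, t + 1)], a divisor of ['C(2t, t)]. *)
Lemma restricted_sum_field (F : fieldType) (s c : seq F) :
    uniq s -> (0 < size s)%N ->
    (forall j, (0 < j)%N -> (j + 3 < (size s).*2)%N -> j%:R != 0 :> F) ->
    (forall x y, x \in s -> y \in s -> x != y -> x + y \in c) ->
  ((size s).*2 - 3 <= size c)%N.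
Proof.
move=> s_uniq s_gt0 char0 sub_c; rewrite leqNgt; apply/negP => ltc.
have {s_gt0 ltc}[t sz_s sz_c]: exists2 t, size s = t.+2 & (size c <= t.*2)%N.
  by exists (size s - 2)%N; lia.
(* Dropping one point makes the top exponents, [t + 1] on [s] and [t] on [b], add up to [2t + 1],
   the degree of [(x - y) * g (x + y)]. *)
pose b := behead s.
have sb : {subset b <= s} by exact: mem_behead.
have b_uniq : uniq b by rewrite /b; case: (s) s_uniq => //= ? ? /andP[].
have sz_b : size b = t.+1 by rewrite size_behead sz_s.
have [w Ew] := top_coef_functional s_uniq.
have [v Ev] := top_coef_functional b_uniq.
pose W i := \sum_(x <- s) w x * x ^+ i.
pose V i := \sum_(y <- b) v y * y ^+ i.
have WE i : (i < t.+2)%N -> W i = (i == t.+1)%:R by rewrite -sz_s => /Ew; rewrite sz_s.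
have VE i : (i < t.+1)%N -> V i = (i == t)%:R by rewrite -sz_b => /Ev; rewrite sz_b.
pose L (f : F -> F -> F) := \sum_(x <- s) \sum_(y <- b) w x * v y * f x y.
have LM i j : L (fun x y => x ^+ i * y ^+ j) = W i * V j.
  rewrite /L /W /V mulr_suml; apply: eq_bigr => x _.
  by rewrite mulr_sumr; apply: eq_bigr => y _; rewrite mulrACA.
have Lx k : L (fun x y => x * (x + y) ^+ k) =
    \sum_(i < k.+1) W (k - i).+1 * V i *+ 'C(k, i).
  transitivity (\sum_(i < k.+1) L (fun x y => x ^+ (k - i).+1 * y ^+ i) *+ 'C(k, i)).
    rewrite /L; under [RHS]eq_bigr do rewrite -sumrMnl.
    rewrite [RHS]exchange_big; apply: eq_bigr => x _.
    under [RHS]eq_bigr do rewrite -sumrMnl.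
    rewrite [RHS]exchange_big; apply: eq_bigr => y _.
    rewrite exprDn mulr_sumr mulr_sumr; apply: eq_bigr => i _.
    by rewrite exprS !mulrnAr !mulrA.
  by apply: eq_bigr => i _; rewrite LM.
have Ly k : L (fun x y => y * (x + y) ^+ k) =
    \sum_(i < k.+1) W i * V (k - i).+1 *+ 'C(k, i).
  transitivity (\sum_(i < k.+1) L (fun x y => x ^+ i * y ^+ (k - i).+1) *+ 'C(k, i)).
    rewrite /L; under [RHS]eq_bigr do rewrite -sumrMnl.
    rewrite [RHS]exchange_big; apply: eq_bigr => x _.
    under [RHS]eq_bigr do rewrite -sumrMnl.
    rewrite [RHS]exchange_big; apply: eq_bigr => y _.
    rewrite addrC exprDn mulr_sumr mulr_sumr; apply: eq_bigr => i _.
    rewrite !mulrnAr; congr (_ *+ _). by rewrite exprS; ring.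
  by apply: eq_bigr => i _; rewrite LM.
(* [W] and [V] are known only up to the exponents [t + 1] and [t]; the bound on [i + j] forces one
   exponent below its top value unless both attain it. *)
have WV0 i j : (i + j <= t.*2.+1)%N -> (i != t.+1) || (j != t) -> W i * V j = 0.
  move=> leij neij; have [lti|lei] := ltnP i t.+1.
    by rewrite WE ?(ltn_eqF lti) ?mul0r //; lia.
  have [ltj|lej] := ltnP j t.
    by rewrite (VE j) ?(ltn_eqF ltj) ?mulr0 //; lia.
  by move: leij lei lej neij; lia.
have WV1 : W t.+1 * V t = 1 by rewrite WE // VE // !eqxx mulr1.
have Llow k : (k < t.*2)%N -> L (fun x y => (x - y) * (x + y) ^+ k) = 0.
  move=> ltk; transitivity (L (fun x y => x * (x + y) ^+ k) -
                         L (fun x y => y * (x + y) ^+ k)).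
    rewrite /L -sumrB; apply: eq_bigr => x _; rewrite -sumrB; apply: eq_bigr => y _.
    by rewrite mulrBl mulrBr.
  rewrite Lx Ly !big1 ?subr0 // => i _; rewrite WV0 ?mul0rn //; have := ltn_ord i; lia.
have Ltop : L (fun x y => (x - y) * (x + y) ^+ t.*2) = 'C(t.*2, t)%:R - 'C(t.*2, t.+1)%:R.
  transitivity (L (fun x y => x * (x + y) ^+ t.*2) - L (fun x y => y * (x + y) ^+ t.*2)).
    rewrite /L -sumrB; apply: eq_bigr => x _; rewrite -sumrB; apply: eq_bigr => y _.
    by rewrite mulrBl mulrBr.
  rewrite Lx Ly; congr (_ - _).
    have lt_t : (t < t.*2.+1)%N by lia.
    rewrite (bigD1 (Ordinal lt_t)) //= [X in _ + X]big1 ?addr0 => [|i neqi].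
      by rewrite (_ : (t.*2 - t)%N = t) ?WV1 //; lia.
    have ?: (i : nat) != t by [].
    by rewrite WV0 ?mul0rn //; have := ltn_ord i; lia.
  case: (posnP t) => [t0|t_gt0].
    rewrite bin_small; last by lia.
    by rewrite big1 // => i _; rewrite WV0 ?mul0rn //; have := ltn_ord i; lia.
  have lt_t : (t.+1 < t.*2.+1)%N by lia.
  rewrite (bigD1 (Ordinal lt_t)) //= [X in _ + X]big1 ?addr0 => [|i neqi].
    by rewrite (_ : (t.*2 - t.+1).+1%N = t) ?WV1 //; lia.
  have ?: (i : nat) != t.+1 by [].
  by rewrite WV0 ?mul0rn //; have := ltn_ord i; lia.
(* The power of ['X] pads the degree to exactly [2t] when [c] has fewer elements. *)
pose g : {poly F} := 'X^(t.*2 - size c) * \prod_(z <- c) ('X - z%:P).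
have g_monic : g \is monic by rewrite monicMl ?monic_prod_XsubC ?monicXn.
have sz_g : size g = t.*2.+1.
  rewrite size_monicM ?monicXn ?monic_neq0 ?monic_prod_XsubC //.
  by rewrite size_polyXn size_prod_XsubC; lia.
have Lg0 : L (fun x y => (x - y) * g.[x + y]) = 0.
  rewrite /L big_seq big1 // => x xs; rewrite big_seq big1 // => y /sb ys.
  have [->|neq] := eqVneq x y; first by rewrite subrr mul0r mulr0.
  rewrite hornerM (_ : (\prod_(z <- c) ('X - z%:P)).[x + y] = 0) ?mulr0 //.
  by apply/rootP; rewrite root_prod_XsubC sub_c.
have LgE : L (fun x y => (x - y) * g.[x + y]) =
    \sum_(k < t.*2.+1) g`_k * L (fun x y => (x - y) * (x + y) ^+ k).
  under [RHS]eq_bigr do rewrite /L mulr_sumr.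
  rewrite [RHS]exchange_big; apply: eq_bigr => x _.
  under [RHS]eq_bigr do rewrite mulr_sumr.
  rewrite [RHS]exchange_big; apply: eq_bigr => y _.
  rewrite horner_coef sz_g !mulr_sumr; apply: eq_bigr => k _.
  by ring.
have Cdiff : 'C(t.*2, t)%:R = 'C(t.*2, t.+1)%:R :> F.
  apply/eqP; rewrite -subr_eq0 -Ltop -[L _]mul1r -(monicP g_monic) lead_coefE sz_g /=.
  move: Lg0; rewrite LgE big_ord_recr /= big1 ?add0r => [->//|k _].
  by rewrite Llow ?mulr0.
(* Equality of the two binomials turns [(t + 1) * 'C(2t, t + 1) = t * 'C(2t, t)] into
   ['C(2t, t) = 0]. *)
have binR0 : 'C(t.*2, t)%:R = 0 :> F.
  have /(congr1 (fun n => n%:R : F)) := mul_bin_left t.*2 t.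
  rewrite !natrM -Cdiff (_ : (t.*2 - t)%N = t); last by lia.
  by rewrite -natr1 mulrDl mul1r => /(canRL (addKr _)); rewrite addNr.
have fact_neq0 : (t.*2)`!%:R != 0 :> F.
  have: (t.*2 <= t.*2)%N by [].
  elim: {-2}t.*2 => [|j IHj] ltj; first by rewrite oner_eq0.
  rewrite factS natrM mulf_neq0 ?IHj ?char0 ?sz_s //; lia.
case/eqP: fact_neq0.
have /bin_fact <- : (t <= t.*2)%N by lia.
by rewrite natrM binR0 mul0r.
Qed.

(** * Product sets in finite abelian groups *)

Section RestrictedProduct.
Local Open Scope nat_scope.
Local Open Scope group_scope.

(** Multiplicative form of [restricted_sumset], giving access to cosets and quotients of finite
    groups. *)
Definition restricted_prod (gT : finGroupType) (A : {set gT}) : {set gT} :=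
  [set a * b | a in A, b in A & a != b].

Lemma restricted_prodP (gT : finGroupType) (A : {set gT}) (x : gT) :
  reflect (exists a b, [/\ a \in A, b \in A, a != b & x = a * b])
          (x \in restricted_prod A).
Proof.
apply: (iffP imset2P) => [[a b aA]|[a [b [aA bA neq ->]]]].
  by rewrite inE => /andP[bA neq] ->; exists a, b.
by exists a b; rewrite ?inE ?bA.
Qed.

(* Induction on [#|B|] by Dyson's transform; if no transform shrinks [B], then
   [A] is stable under a nontrivial cyclic subgroup. *)
Lemma cauchy_davenport (gT : finGroupType) (G : {group gT}) (p : nat)
    (A B : {set gT}) :
    abelian G -> (forall q, prime q -> q %| #|G| -> p <= q) ->
    A \subset G -> B \subset G -> A != set0 -> B != set0 ->
  minn p (#|A| + #|B| - 1) <= #|A * B|.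
Proof.
move=> cGG minp; move: {2}#|B|.+1 (ltnSn #|B|) => n.
elim: n => // n IHn in A B *; rewrite ltnS => leBn sAG sBG A_neq0 B_neq0.
have mulC x y : x \in G -> y \in G -> x * y = y * x by move=> *; apply: (centsP cGG).
have [a0 a0A] := set0Pn _ A_neq0; have [b0 b0B] := set0Pn _ B_neq0.
have leA : #|A| <= #|A * B|.
  rewrite -(card_rcoset A b0) subset_leq_card //.
  by rewrite mulgS ?sub1set.
have [B1|/card_gt1P[b [c [bB cB neq_bc]]]] := leqP #|B| 1.
  by rewrite (leq_trans (geq_minr _ _)) // (leq_trans _ leA) //; lia.
have [/forall_inP stab|] := boolP [forall a in A, c * b^-1 * a \in A].
  pose x := c * b^-1.
  have x_neq1 : x != 1 by rewrite -eq_mulgV1 eq_sym.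
  have xG : x \in G by rewrite groupM ?groupV ?(subsetP sBG).
  have sxA : <[x]> :* a0 \subset A.
    apply/subsetP => _ /rcosetP[_ /cycleP[i ->] ->].
    by elim: i => [|i IHi]; rewrite ?mul1g // expgS -mulgA stab.
  rewrite (leq_trans (geq_minl _ _)) // (leq_trans _ leA) //.
  rewrite (leq_trans _ (subset_leq_card sxA)) // card_rcoset -orderE.
  have gt1x : 1 < #[x] by rewrite order_gt1.
  rewrite (leq_trans _ (pdiv_leq (ltnW gt1x))) // minp ?pdiv_prime //.
  by rewrite (dvdn_trans (pdiv_dvd _)) // order_dvdG.
rewrite negb_forall_in => /exists_inP[a aA nstab].
(* With this shift [b * e = a] lies in [A] while [c * e] does not, so the transform keeps [b] in
   [B'] and removes [c]. *)
pose e := b^-1 * a.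
pose A' := A :|: B :* e; pose B' := B :&: A :* e^-1.
have aG := subsetP sAG a aA; have bG := subsetP sBG b bB.
have eG : e \in G by rewrite groupM ?groupV.
have B'e : B' :* e = B :* e :&: A.
  by apply/setP => z; rewrite !(inE, mem_rcoset) invgK -mulgA mulVg mulg1.
have cardAB : #|A'| + #|B'| = #|A| + #|B|.
  by rewrite -(card_rcoset B' e) B'e -(card_rcoset B e) setIC cardsUI.
have bB' : b \in B'.
  by rewrite !(inE, mem_rcoset) bB invgK mulKVg.
have ltB' : #|B'| < #|B|.
  apply/proper_card/properP; split; first exact: subsetIl.
  exists c => //; rewrite !(inE, mem_rcoset) cB invgK.
  by rewrite mulgA.
have sB'B : B' \subset B by exact: subsetIl.
have sA'B' : A' * B' \subset A * B.
  apply/subsetP => _ /mulsgP[x y + /setIP[yB yA] ->].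
  case/setUP => [xA|/rcosetP[b' b'B ->]]; first exact: mem_mulg.
  have /rcosetP[a' a'A ya'] := yA.
  have a'G := subsetP sAG _ a'A; have b'G := subsetP sBG _ b'B.
  rewrite (_ : _ * y = a' * b') ?mem_mulg // ya' -mulgA (mulC a') ?groupV //.
  by rewrite mulKVg mulC.
rewrite (leq_trans _ (subset_leq_card sA'B')) // -cardAB IHn //.
- exact: leq_trans ltB' leBn.
- rewrite subUset sAG; apply/subsetP => _ /rcosetP[b' b'B ->].
  by rewrite groupM // (subsetP sBG).
- exact: subset_trans sBG.
- by apply/set0Pn; exists a0; rewrite inE a0A.
- by apply/set0Pn; exists b.
Qed.

(** The map sending [i] to [x ^ i] carries the additive group of the prime field onto [<[x]>], so
    the field case applies; the size hypothesis keeps the integers that must be nonzero in the field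
    below [#[x]]. *)
Lemma restricted_prod_cycle (gT : finGroupType) (x : gT) (A : {set gT}) :
    prime #[x] -> A \subset <[x]> -> #|A|.*2 <= #[x] + 3 ->
  #|A|.*2 - 3 <= #|restricted_prod A|.
Proof.
move=> pr_x sAx leAx.
have [->|A_neq0] := eqVneq A set0; first by rewrite cards0.
pose f (i : 'F_#[x]) : gT := x ^+ i.
have modE i : i %% (Zp_trunc (pdiv #[x])).+2 = i %% #[x] by rewrite Fp_cast.
have ltx (i : 'F_#[x]) : i < #[x] by rewrite -[X in _ < X](Fp_cast pr_x).
have fD i j : f (i + j)%R = f i * f j.
  by rewrite /f -expgD /= modE expg_mod_order.
have f_inj : injective f.
  by move=> i j /eqP; rewrite /f eq_expg_mod_order !modn_small // => /eqP /val_inj.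
have le_pre (S : {set gT}) : #|f @^-1: S| <= #|S|.
  rewrite -(card_imset _ f_inj) subset_leq_card //.
  by apply/subsetP => _ /imsetP[i + ->]; rewrite inE.
have cardA : #|f @^-1: A| = #|A|.
  apply/eqP; rewrite eqn_leq le_pre /=.
  rewrite -(card_imset _ f_inj) subset_leq_card //; apply/subsetP => y yA.
  have /cyclePmin[i ltix yE] := subsetP sAx y yA.
  have fi : f (inZp i) = y by rewrite /f /= modE modn_small.
  by apply/imsetP; exists (inZp i); rewrite ?inE fi.
apply: leq_trans (le_pre _); rewrite -cardA !cardE.
apply: restricted_sum_field; rewrite ?enum_uniq -?cardE ?cardA ?card_gt0 //.
  move=> j j_gt0 ltj; rewrite -(dvdn_pcharf (pchar_Fp pr_x)) gtnNdvd //; lia.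
move=> i j; rewrite !mem_enum !inE => iA jA neq_ij; rewrite fD.
by apply/restricted_prodP; exists (f i), (f j); rewrite (inj_eq f_inj).
Qed.

(** Serves to move a fibre, which lies in one coset of a subgroup, into the subgroup itself. *)
Lemma restricted_prod_rcoset (gT : finGroupType) (y : gT) (A : {set gT}) :
  A \subset 'C[y] -> restricted_prod (A :* y) \subset restricted_prod A :* (y * y).
Proof.
move/subsetP=> cAy; apply/subsetP => z /restricted_prodP[u [v []]].
case/rcosetP=> a aA -> /rcosetP[b bA ->]; rewrite (inj_eq (mulIg y)) => neq ->.
have /cent1P cyb := cAy b bA.
apply/rcosetP; exists (a * b); first by apply/restricted_prodP; exists a, b.
by rewrite -!mulgA; congr (_ * _); rewrite !mulgA cyb.
Qed.

Lemma erdos_heilbronn (p : nat) (gT : finGroupType) (G : {group gT})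
    (A : {set gT}) :
    abelian G -> (forall q, prime q -> q %| #|G| -> p <= q) ->
    A \subset G -> #|A|.*2 <= p + 3 ->
  #|A|.*2 - 3 <= #|restricted_prod A|.
Proof.
move: {2}#|G|.+1 (ltnSn #|G|) => n; elim: n => // n IHn in gT G A *.
rewrite ltnS => leGn cGG minp sAG leAp.
have [A1|A_gt1] := leqP #|A| 1; first by lia.
have ltG1 : 1 < #|G| by apply: leq_trans A_gt1 (subset_leq_card sAG).
have pr_q := pdiv_prime ltG1.
have [x xG ox] := Cauchy pr_q (pdiv_dvd _).
have pr_x : prime #[x] by rewrite ox.
have lepx : p <= #[x] by rewrite ox minp // pdiv_dvd.
pose H := <[x]>%G.
have sHG : H \subset G by rewrite cycle_subG.
have nsHG : H <| G by rewrite -sub_abelian_normal.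
have nHG := normal_norm nsHG.
have ntH : H :!=: 1 by rewrite -cardG_gt1 -orderE ox prime_gt1.
have AG a : a \in A -> a \in G by apply/subsetP.
have phiM a b : a \in A -> b \in A -> coset H (a * b) = coset H a * coset H b.
  by move=> /AG aG /AG bG; rewrite morphM // (subsetP nHG).
pose R := restricted_prod A.
pose K := coset H @: A.
pose fib (S : {set gT}) u := [set z in S | coset H z == u].
pose a u := #|fib A u|.
have inK z : z \in A -> coset H z \in K by exact: imset_f.
have sumA : \sum_(u in K) a u = #|A|.
  rewrite -sum1_card (partition_big (coset H) (mem K)) //=.
  by apply: eq_bigr => u _; rewrite /a -sum1_card; apply: eq_bigl => z; rewrite inE.
have sumR : \sum_u #|fib R u| = #|R|.
  rewrite -sum1_card (partition_big (coset H) xpredT) //=.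
  by apply: eq_bigr => u _; rewrite -sum1_card; apply: eq_bigl => z; rewrite inE.
have a_gt0 u : u \in K -> 0 < a u.
  by case/imsetP => z zA ->; apply/card_gt0P; exists z; rewrite inE zA eqxx.
have [z0 z0A] : exists z, z \in A by apply/card_gt0P/ltnW.
have [u1 u1K maxu1] : exists2 u, u \in K & forall v, v \in K -> a v <= a u.
  by case: (arg_maxnP a (inK _ z0A)) => u uK max_u; exists u.
have sKG : K \subset G / H.
  by apply/subsetP => _ /imsetP[z zA ->]; rewrite mem_quotient ?AG.
have cKK : abelian (G / H) by exact: quotient_abelian.
have minpK q : prime q -> q %| #|G / H| -> p <= q.
  by move=> pr_q' dv; apply: minp => //; apply: dvdn_trans dv (dvdn_quotient _ _).
have leKA : #|K| <= #|A| by exact: leq_imset_card.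
(* If all fibres are singletons, the quotient map is injective on [A], and every restricted product
   in the quotient lifts to one of [A]. *)
have [a1|a_gt1] := leqP (a u1) 1.
  have leAK : #|A| <= #|K|.
    rewrite -sumA -sum1_card leq_sum // => u uK.
    exact: leq_trans (maxu1 u uK) a1.
  have eqAK : #|A| = #|K| by apply/eqP; rewrite eqn_leq leAK.
  rewrite eqAK (leq_trans (IHn _ (G / H)%G K _ cKK minpK sKG _)) -?eqAK //.
    by rewrite (leq_trans _ leGn) // ltn_quotient.
  rewrite (leq_trans _ (leq_imset_card (coset H) _)) // subset_leq_card //.
  apply/subsetP => _ /restricted_prodP[u [v [/imsetP[b bA ->] /imsetP[c cA ->] neq ->]]].
  rewrite -phiM // imset_f //; apply/restricted_prodP; exists b, c; split=> //.
  by apply: contraNneq neq => ->.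
have sfib u : fib A u \subset A by apply/subsetP => z; rewrite inE => /andP[].
have r_off v : v \in K -> v != u1 -> a u1 + a v <= #|fib R (u1 * v)|.+1.
  move=> vK neq.
  have sub : fib A u1 * fib A v \subset fib R (u1 * v).
    apply/subsetP => z /mulsgP[b c].
    rewrite !inE => /andP[bA /eqP bu] /andP[cA /eqP cv] ->.
    rewrite phiM // bu cv eqxx andbT; apply/restricted_prodP; exists b, c; split=> //.
    by apply: contraNneq neq => bc; rewrite -cv -bc bu.
  have := @cauchy_davenport _ G p (fib A u1) (fib A v) cGG minp.
  rewrite !(subset_trans (sfib _)) // -!card_gt0 !a_gt0 // => /(_ isT isT isT isT).
  have := subset_leq_card sub; rewrite -/(a u1) -/(a v).
  (* This keeps the Cauchy-Davenport bound from being cut off at [p]. *)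
  have : a u1 + a v <= #|A|.
    by rewrite -sumA (bigD1 u1) //= (bigD1 v) /= ?vK // addnA leq_addr.
  move: leAp a_gt1; rewrite -/(a u1) -/(a v); clear.
  move: #|A| #|fib A u1 * fib A v| #|fib R _| (a u1) (a v) => cA cAA cR au av; lia.
have r_diag : (a u1).*2 - 3 <= #|fib R (u1 * u1)|.
  have [y /[!inE] /andP[yA /eqP yu1]] := card_gt0P (a_gt0 _ u1K).
  have cGy z : z \in A -> z \in 'C[y^-1].
    by move=> zA; apply/cent1P; apply: (centsP cGG); rewrite ?groupV ?AG.
  have cAy : fib A u1 \subset 'C[y^-1] by apply/subsetP => z /(subsetP (sfib _)) /cGy.
  have sBH : fib A u1 :* y^-1 \subset H.
    apply/subsetP => z; rewrite mem_rcoset invgK inE => /andP[zyA /eqP zyu].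
    rewrite -(mulgK y z) -mem_rcoset.
    by apply/rcoset_kercosetP; rewrite ?(subsetP nHG) ?AG // zyu yu1.
  have le_a1 : a u1 <= #|A| by rewrite subset_leq_card.
  have := restricted_prod_cycle pr_x sBH; rewrite card_rcoset => /(_ _).
  have -> : #|fib A u1|.*2 <= #[x] + 3.
    apply: leq_trans (leq_trans leAp _); first by rewrite leq_double.
    by rewrite leq_add2r.
  move=> /(_ isT) le_r; apply: leq_trans le_r _.
  rewrite (leq_trans (subset_leq_card (restricted_prod_rcoset cAy))) // card_rcoset.
  rewrite subset_leq_card //; apply/subsetP => z /restricted_prodP[b [c []]].
  rewrite !inE => /andP[bA /eqP bu] /andP[cA /eqP cu] neq ->.
  rewrite phiM // bu cu eqxx andbT; by apply/restricted_prodP; exists b, c.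
(* A point of [T] has a single lift, so its square need not be the image of a restricted product;
   [D] collects the products not already counted in the translate of [K] by [u1]. *)
pose T := [set v in K | a v == 1%N].
pose T2 := [set v * v | v in T].
pose D := K * K :\: [set u1 * v | v in K].
have r_rest w : w \in D :\: T2 -> 0 < #|fib R w|.
  rewrite !inE => /and3P[wT2 wnot /mulsgP[u v uK vK wE]].
  have [b bA uE] := imsetP uK; have [c cA vE] := imsetP vK; rewrite {}uE {}vE in wE uK vK.
  have [eq_uv|neq_uv] := eqVneq (coset H b) (coset H c); last first.
    apply/card_gt0P; exists (b * c); rewrite inE wE phiM // eqxx andbT.
    apply/restricted_prodP; exists b, c; split=> //.
    by apply: contraNneq neq_uv => ->.
  have /card_gt1P[y [z []]] : 1 < a (coset H c).
    rewrite ltn_neqAle a_gt0 ?inK // andbT eq_sym; apply: contra wT2 => ac1.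
    by apply/imsetP; exists (coset H c); rewrite ?inE ?inK // wE eq_uv.
  rewrite !inE => /andP[yA /eqP yc] /andP[zA /eqP zc] neq_yz.
  apply/card_gt0P; exists (y * z); rewrite inE phiM // yc zc wE eq_uv eqxx andbT.
  by apply/restricted_prodP; exists y, z.
(* A fibre with two points makes [K] smaller than [A], whence [2 #|K| - 1 <= p] and Cauchy-Davenport
   in the quotient is not cut off either. *)
have ltKA : #|K| < #|A|.
  rewrite -sumA -sum1_card (bigD1 u1 u1K) [ltnRHS](bigD1 u1 u1K) /= -addSn.
  by rewrite leq_add // leq_sum // => v /andP[/a_gt0].
have cardK2 : #|K|.*2 <= #|K * K|.+1.
  have K_neq0 : K != set0 by apply/set0Pn; exists u1.
  have := @cauchy_davenport _ (G / H)%G p K K cKK minpK sKG sKG K_neq0 K_neq0.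
  move: ltKA leAp; clear; move: #|K| #|K * K| #|A| => cK cKK cA; lia.
have cardD : #|K * K| <= #|D :\: T2| + #|K| + #|T|.
  have leT2 : #|T2| <= #|T| by exact: leq_imset_card.
  have leuK : #|[set u1 * v | v in K]| <= #|K| by exact: leq_imset_card.
  have := subset_leq_card (subsetIr D T2); have := cardsID T2 D.
  have := subset_leq_card (subsetIr (K * K) [set u1 * v | v in K]).
  have := cardsID [set u1 * v | v in K] (K * K); rewrite -/D.
  move: leT2 leuK; clear.
  move: #|D :&: T2| #|K * K :&: _| #|D :\: T2| #|D| => c1 c2 c3 c4.
  move: #|T2| #|T| #|K| #|K * K| #|[set _ | _ in _]| => c5 c6 c7 c8 c9; lia.
(* Each point of [T] falls short of the maximal fibre size by [a u1 - 1]. *)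
have mT : (#|A| + #|T| * (a u1 - 1) <= #|K| * a u1)%N.
  rewrite -sumA -!sum_nat_const.
  rewrite [X in _ + X <= _](eq_bigl (fun v => (v \in K) && (a v == 1%N))); last first.
    by move=> v; rewrite inE.
  rewrite [X in _ + X]big_mkcondr -big_split /=.
  rewrite leq_sum // => v vK; case: eqP => [->|_]; first by rewrite subnKC // ltnW.
  by rewrite addn0 maxu1.
have leR : \sum_(v in K) #|fib R (u1 * v)%g| + #|D :\: T2| <= #|R|.
  pose U := [set u1 * v | v in K].
  have -> : #|R| = \sum_(w in U) #|fib R w| + \sum_(w | w \notin U) #|fib R w|.
    by rewrite -sumR (bigID (mem U)).
  rewrite [X in _ <= X + _]big_imset /= => [|v w _ _]; last exact: mulgI.
  rewrite leq_add2l -sum1_card.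
  rewrite [leqLHS]big_mkcond [leqRHS]big_mkcond leq_sum //= => w _.
  case: ifP => // wD; have := r_rest w wD.
  by case/setDP: wD => /setDP[_ ->].
(* The losses, [3] from [r_diag] and [1] from each [r_off], stand on the right to avoid truncated
   subtraction. *)
have leS : (a u1).*2 + ((#|K| - 1) * a u1)%N + (#|A| - a u1) <=
    \sum_(v in K) #|fib R (u1 * v)%g| + (#|K| - 1) + 3.
  have cardK1 : #|[pred v in K | v != u1]| = #|K| - 1.
    by rewrite (cardD1 u1 K) u1K addKn; apply: eq_card => v; rewrite !inE andbC.
  rewrite (bigD1 u1 u1K) /= -cardK1 -sum_nat_const -sumA (bigD1 u1 u1K) /= addKn.
  have : \sum_(v in K | v != u1) (a u1 + a v) <=
      \sum_(v in K | v != u1) (#|fib R (u1 * v)%g| + 1).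
    by apply: leq_sum => v /andP[vK neq]; rewrite addn1 r_off.
  rewrite !big_split /= sum1_card.
  move: r_diag; clear; move: #|fib R (u1 * u1)| (\sum_(_ in _ | _) #|_|) => c1 c2.
  move: (\sum_(_ in _ | _) _) (\sum_(_ in _ | _) _) (a u1) #|_| => c3 c4 c5 c6. lia.
have : a u1 <= #|A| by rewrite subset_leq_card.
have : 0 < #|K| by apply/card_gt0P; exists u1.
move: mT leR leS cardD cardK2 a_gt1; clear.
move: #|R| (\sum_(_ in _) _) #|D :\: T2| (a u1) #|K| #|A| #|T| #|K * K|.
move=> r rK rD a1 s m t s2.
rewrite mulnBl mul1n => mT leR leS cardD cardK2 a1_gt1 s_gt0 le_a1m.
(* The counts give [r >= s * a1 + m - t - 3], and [mT] with this inequality gives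
   [s * a1 >= m + t]. *)
have : t <= t * (a1 - 1) by rewrite leq_pmulr // subn_gt0.
have : a1 <= s * a1 by rewrite leq_pmull.
lia.
Qed.
End RestrictedProduct.

(** * Colorings of the integers modulo [n] *)

Lemma card_restricted_sumset (n : nat) (A : {set 'Z_n}) :
    (2 <= n)%N -> (#|A|.*2 <= pdiv n + 3)%N ->
  (#|A|.*2 - 3 <= #|restricted_sumset A|)%N.
Proof.
move=> n_gt1 leA; have cardZ : #|[set: 'Z_n]| = n by rewrite cardsT card_ord Zp_cast.
have cZZ : abelian [set: 'Z_n] by apply/centsP => x _ y _; apply: addrC.
(* The group law of ['Z_n] is its addition, so [restricted_prod] and [restricted_sumset] agree by
   conversion. *)
apply: (erdos_heilbronn cZZ) leA; last exact: subsetT.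
by move=> q pr_q; rewrite cardZ; apply: pdiv_min_dvd; apply: prime_gt1.
Qed.

(** Class [i] is an interval of length at most [m] starting at [i * m]. Two distinct members have
    distinct remainders modulo [m], whose sum lies between [1] and [2m - 3]; this leaves [2m - 3]
    possible sums. *)
Lemma interval_coloring (n k m : nat) : (2 <= n)%N -> (0 < m)%N -> (n <= k * m)%N ->
  exists2 A : {ffun 'I_k -> {set 'Z_n}},
    is_coloring A & (max_restricted_sumset A <= m.*2 - 3)%N.
Proof.
move=> n_gt1 m_gt0 le_n.
exists [ffun i : 'I_k => [set x : 'Z_n | (x %/ m)%N == i]].
  apply/andP; split.
    apply/forallP => i; apply/forallP => j; apply/implyP => neq_ij.
    rewrite !ffunE disjoints_subset; apply/subsetP => x; rewrite !inE => /eqP->.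
    by rewrite -(inj_eq val_inj) in neq_ij.
  apply/eqP/setP => x; rewrite inE; apply/bigcupP.
  have ltxk : (x %/ m < k)%N.
    by rewrite ltn_divLR // (leq_trans _ le_n) // -[X in (_ < X)%N](Zp_cast n_gt1).
  by exists (Ordinal ltxk) => //; rewrite ffunE inE.
apply/bigmax_leqP => i _; rewrite ffunE.
rewrite -[leqRHS]card_ord.
apply: leq_trans (leq_imset_card
  (fun j : 'I_(m.*2 - 3) => (i * m + i * m + j.+1)%:R : 'Z_n) _).
apply/subset_leq_card/subsetP => _ /imset2P[x y + /setIdP[+ neq] ->].
rewrite !inE => /eqP xi /eqP yi.
have : (x %% m != y %% m)%N.
  apply: contraNneq neq => eq_mod; apply/eqP/val_inj.
  by rewrite /= (divn_eq x m) (divn_eq y m) xi yi eq_mod.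
have := ltn_pmod x m_gt0; have := ltn_pmod y m_gt0 => lty ltx neq_mod.
have ltj : ((x %% m + y %% m).-1 < m.*2 - 3)%N by lia.
apply/imsetP; exists (Ordinal ltj) => //=.
have valE (z : 'Z_n) : (z %/ m)%N = i -> z = (i * m + z %% m)%:R :> 'Z_n.
  by move=> zi; rewrite -[LHS]natr_Zp [in LHS](divn_eq z m) zi.
by rewrite [x in LHS]valE // [y in LHS]valE // -natrD; congr (_%:R); lia.
Qed.

Lemma coloring_large_class (n k m : nat) (A : {ffun 'I_k -> {set 'Z_n}}) :
  (2 <= n)%N -> is_coloring A -> (k * m < n)%N -> exists i, (m < #|A i|)%N.
Proof.
move=> n_gt1 /andP[_ /eqP covA] lt_n.
apply/existsP; apply: contraLR lt_n; rewrite negb_exists -leqNgt => /forallP leA.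
have <- : #|\bigcup_i A i| = n by rewrite covA cardsT card_ord Zp_cast.
have : (#|\bigcup_i A i| <= \sum_i #|A i|)%N.
  elim/big_ind2: _ => [|a X b Y leX leY|//]; first by rewrite cards0.
  by rewrite (leq_trans (leq_card_setU X Y)) // leq_add.
move/leq_trans; apply.
by rewrite -[k in leqRHS]card_ord -sum_nat_const leq_sum // => i _; rewrite leqNgt.
Qed.

(** Writes the ceiling as a successor with both of its bounds: the lower one feeds the pigeonhole
    argument, the upper one the interval coloring. *)
Lemma ceil_divn (n k : nat) : (0 < n)%N -> (0 < k)%N ->
  exists m, [/\ Num.ceil (n%:R / k%:R : rat) = m.+1, (k * m < n)%N & (n <= k * m.+1)%N].
Proof.
move=> n_gt0 k_gt0; exists (n.-1 %/ k)%N.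
have lt_n : (k * (n.-1 %/ k) < n)%N by have := leq_trunc_div n.-1 k; lia.
have le_n : (n <= k * (n.-1 %/ k).+1)%N by have := ltn_ceil n.-1 k_gt0; lia.
split=> //; apply: ceil_def.
have k_gt0' : 0 < k%:R :> rat by rewrite ltr0n.
have -> : (n.-1 %/ k).+1%:Z - 1 = (n.-1 %/ k)%N by lia.
rewrite -!pmulrn ltr_pdivlMr // ler_pdivrMr // -!natrM ltr_nat ler_nat.
by rewrite mulnC lt_n mulnC.
Qed.

Theorem theorem4 (n k : nat) (hn : (2 <= n)%N) (hk : (2 <= k)%N)
    (hp : 2 * Num.ceil (n%:R / k%:R : rat) - 3 <= (pdiv n)%:Z) :
  (Phi k n)%:Z = Num.max 0 (2 * Num.ceil (n%:R / k%:R : rat) - 3).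
Proof.
have k_gt0 := ltnW hk.
have [m [ceilE lt_n le_n]] := ceil_divn (ltnW hn) k_gt0.
rewrite ceilE in hp *.
have [[A colA maxA] minPhi] := PhiP n k_gt0.
(* Truncated subtraction in [nat] plays the part of the maximum with [0]. *)
suff -> : Phi k n = (m.+1.*2 - 3)%N by lia.
apply/eqP; rewrite eqn_leq; apply/andP; split.
  have [B colB leB] := @interval_coloring n k m.+1 hn isT le_n.
  exact: leq_trans (minPhi B colB) leB.
have [i lt_m] := coloring_large_class hn colA lt_n.
(* The class may be too large for the size condition of the sumset bound; a subset of exactly
   [m + 1] elements meets it by [hp]. *)
have [B sBA cardB] : exists2 B : {set 'Z_n}, B \subset A i & #|B| = m.+1.
  have /card_gt0P[B] : (0 < #|[set B : {set 'Z_n} | B \subset A i & #|B| == m.+1]|)%N.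
    by rewrite cards_draws bin_gt0.
  by rewrite inE => /andP[sBA /eqP cardB]; exists B.
have := @card_restricted_sumset n B hn; rewrite cardB => /(_ ltac:(lia)) le_sum.
rewrite -maxA; apply: leq_trans (leq_bigmax i); apply: leq_trans le_sum _.
apply/subset_leq_card/subsetP => _ /imset2P[x y xB /setIdP[yB neq] ->].
by apply/imset2P; exists x y; rewrite ?inE ?(subsetP sBA) // neq.
Qed.
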